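(* Let $n\ge 2$ and let $\mathbf{A}\subset\mathbb{R}^{n\times n}$ be a connected set of real matrices. For $A\in\mathbf{A}$ write its characteristic polynomial as $f_A(s)=\det(sI_n-A)=s^n+a_{n-1}s^{n-1}+\cdots+a_1s+a_0$, and let $\Delta_{n-1}$ denote the $(n-1)$-th leading principal minor of the Hurwitz matrix $\Delta_A$ of $f_A$ (all these quantities depend on $A$). Suppose that at least one $A\in\mathbf{A}$ is Hurwitz stable. Then every $A\in\mathbf{A}$ is Hurwitz stable if and only if $a_0>0$ and $\Delta_{n-1}>0$ for all $A\in\mathbf{A}$.
   Context: A real square matrix is Hurwitz stable if all its eigenvalues lie in the open left half of the complex plane. The Hurwitz matrix of $f_A(s)=s^n+a_{n-1}s^{n-1}+\cdots+a_0$ is the $n\times n$ matrix $\Delta_A=(h_{ij})$ with $h_{ij}=a_{n-2j+i}$, where one sets $a_n=1$ and $a_k=0$ for $k<0$ or $k>n$; explicitly its rows are $(a_{n-1},a_{n-3},a_{n-5},\dots)$, $(1,a_{n-2},a_{n-4},\dots)$, $(0,a_{n-1},a_{n-3},\dots)$, $(0,1,a_{n-2},\dots)$, and so on. Its successive leading principal minors are denoted $\Delta_1,\dots,\Delta_n$. *)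

(* Defs.v *)
From Stdlib Require Import Reals List ZArith Arith.
Open Scope R_scope.

(* An n x n real matrix is represented as a function nat -> nat -> R;
   only the entries with indices i, j < n are relevant (0-indexed). *)
Definition mat := nat -> nat -> R.

Fixpoint lsum {T : Type} (zero : T) (add : T -> T -> T) (f : nat -> T) (m : nat) : T :=
  match m with
  | O => zero
  | S m' => add (lsum zero add f m') (f m')
  end.

Definition minor {T : Type} (M : nat -> nat -> T) (j : nat) : nat -> nat -> T :=
  fun r c => M (S r) (if (c <? j)%nat then c else S c).

Fixpoint gdet {T : Type} (zero one : T) (add mul : T -> T -> T) (opp : T -> T)
    (k : nat) (M : nat -> nat -> T) : T :=
  match k with
  | O => one
  | S k' =>
      lsum zero add
        (fun j => let t := mul (M O j) (gdet zero one add mul opp k' (minor M j)) in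
                  if Nat.even j then t else opp t)
        (S k')
  end.

(* ---------- real polynomials as coefficient lists (constant term first) ---------- *)
Definition poly := list R.
Fixpoint padd (p q : poly) : poly :=
  match p, q with
  | nil, _ => q
  | _, nil => p
  | a :: p', b :: q' => (a + b) :: padd p' q'
  end.
Fixpoint pmul (p q : poly) : poly :=
  match p with
  | nil => nil
  | a :: p' => padd (map (Rmult a) q) (0 :: pmul p' q)
  end.
Definition popp (p : poly) : poly := map Ropp p.

Definition charpoly (n : nat) (A : mat) : poly :=
  gdet nil (1 :: nil) padd pmul popp n
    (fun i j => padd (if (i =? j)%nat then (0 :: 1 :: nil) else nil) (popp (A i j :: nil))).

Definition charcoef (n : nat) (A : mat) (k : Z) : R :=
  if (k =? Z.of_nat n)%Z then 1
  else if ((0 <=? k)%Z && (k <? Z.of_nat n)%Z)%bool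
       then nth (Z.to_nat k) (charpoly n A) 0
       else 0.

(* Hurwitz matrix of f_A, 0-indexed: entry (i,j) is h_{(i+1)(j+1)} = a_{n-2(j+1)+(i+1)} *)
Definition hurwitz_matrix (n : nat) (A : mat) : mat :=
  fun i j => charcoef n A (Z.of_nat n - 2 * Z.of_nat j + Z.of_nat i - 1)%Z.

Definition hurwitz_minor (n : nat) (A : mat) (k : nat) : R :=
  gdet 0 1 Rplus Rmult Ropp k (hurwitz_matrix n A).

Definition C := (R * R)%type.
Definition Cadd (z w : C) : C := (fst z + fst w, snd z + snd w).
Definition Cmul (z w : C) : C :=
  (fst z * fst w - snd z * snd w, fst z * snd w + snd z * fst w).
Definition Copp (z : C) : C := (- fst z, - snd z).
Definition C0 : C := (0, 0).
Definition C1 : C := (1, 0).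

Definition eigenvalue (n : nat) (A : mat) (lam : C) : Prop :=
  gdet C0 C1 Cadd Cmul Copp n
    (fun i j => Cadd (if (i =? j)%nat then lam else C0) (Copp (A i j, 0))) = C0.

Definition hurwitz_stable (n : nat) (A : mat) : Prop :=
  forall lam : C, eigenvalue n A lam -> fst lam < 0.

Definition is_open (n : nat) (U : mat -> Prop) : Prop :=
  forall X, U X -> exists eps, 0 < eps /\
    forall Y, (forall i j, (i < n)%nat -> (j < n)%nat -> Rabs (Y i j - X i j) < eps) -> U Y.

Definition connected (n : nat) (S : mat -> Prop) : Prop :=
  ~ exists U V : mat -> Prop,
      is_open n U /\ is_open n V /\
      (forall X, S X -> U X \/ V X) /\
      (exists X, S X /\ U X) /\ (exists X, S X /\ V X) /\
      (forall X, S X -> U X -> V X -> False).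

(* Main.v *)
Require Import Defs.
From Stdlib Require Import Reals List ZArith Arith Classical.
From mathcomp Require all_boot all_order all_fingroup all_algebra complex Rstruct zify.
From mathcomp Require ring lra.
Open Scope R_scope.

(** The key is Orlando's formula: the minor [Delta_{n-1}] of a monic polynomial
    with complex roots [l_1, ..., l_n] equals the product of the [-(l_i + l_j)]
    over [i < j].  Pairing conjugate roots, it is positive for a stable real
    polynomial, and so is [a_0]; conversely a root on the imaginary axis is
    either [0], so that [a_0 = 0], or has an opposite conjugate, so that
    [Delta_{n-1} = 0].  Hence, when [a_0] and [Delta_{n-1}] are positive on
    [Aset], [Aset] is covered by the disjoint open sets of stable matrices and
    of matrices having an eigenvalue of positive real part, and connectedness
    leaves only the former. *)

Module Orlando.
Import all_boot all_order all_fingroup all_algebra complex Rstruct zify ring lra.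
Import Order.TTheory GRing.Theory Num.Theory.
Set Implicit Arguments.
Unset Strict Implicit.
Unset Printing Implicit Defensive.
Local Open Scope ring_scope.

(** * Orlando's formula *)

Lemma sum_nat_double (V : nmodType) (F : nat -> V) n :
  \sum_(0 <= m < n.*2) F m = \sum_(0 <= l < n) (F l.*2 + F l.*2.+1).
Proof.
elim: n => [|n IHn]; first by rewrite !big_geq.
by rewrite doubleS !big_nat_recr //= IHn addrA.
Qed.

(* Leading block of order [N] of the Hurwitz matrix of a polynomial of degree [N + 1]. *)
Definition hurwitz_mx (R : nzRingType) N (p : {poly R}) : 'M[R]_N :=
  \matrix_(i, j) (if (j.*2 <= N + i)%N then p`_(N + i - j.*2) else 0).

(* Row [i] collects the coefficients of one parity, and [p(x) = 0] makes the even
   and odd parts of [p] at [x] equal to [+-p(-x)/2]. *)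
Lemma hurwitz_mx_root (R : comNzRingType) N (p : {poly R}) (x : R) (i : 'I_N) :
  (size p <= N.+2)%N -> p.[x] = 0 ->
  2 * (\sum_j hurwitz_mx N p i j * (x ^+ 2) ^+ (N - j)) =
  (- x) ^+ (N - i) * p.[- x].
Proof.
move=> szp px0.
have lt_iN := ltn_ord i.
(* The factor [1 + (-1) ^+ m] kills odd exponents. Read at [m = 2 * (N - j)], the sum of [F] is the
   Hurwitz row; read at [m = k + (N - i)], it is the combination of [p.[x]] and [p.[- x]]. *)
pose F m := (if (N <= m + i)%N then p`_(m + i - N) else 0) * x ^+ m * (1 + (-1) ^+ m).
transitivity (\sum_(0 <= m < N.+1.*2) F m).
  rewrite sum_nat_double big_nat_recl // big_mkord {1}/F leqNgt add0n lt_iN /=.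
  rewrite mul0r mul0r add0r {1}/F.
  have -> : ((if (N <= 1 + i)%N then p`_(1 + i - N) else 0) * x ^+ 1 *
     (1 + (-1) ^+ 1)) = 0 by rewrite expr1 subrr mulr0.
  rewrite add0r (reindex_inj rev_ord_inj) mulr_sumr; apply: eq_bigr => j _ /=.
  have lt_jN := ltn_ord j.
  have sgn_even m : (-1) ^+ m.*2 = 1 :> R by rewrite -signr_odd odd_double.
  have sgn_odd m : (-1) ^+ m.*2.+1 = -1 :> R by rewrite exprS sgn_even mulr1.
  rewrite mxE /F sgn_odd sgn_even subrr mulr0 addr0 -exprM.
  have -> : (2 * (N - (N - j.+1)) = (j.+1).*2)%N by lia.
  have -> : (N <= j.+1.*2 + i)%N = ((N - j.+1).*2 <= N + i)%N by lia.
  have -> : (N + i - (N - j.+1).*2 = j.+1.*2 + i - N)%N by lia.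
  by rewrite [nat_of_ord (rev_ord j)]/=; case: ifP => _; ring.
rewrite (big_cat_nat (n := (N - i)%N)) //=; last by lia.
rewrite [X in X + _]big_nat_cond big1 ?add0r; last first.
  by move=> m /andP[/andP[_ lt_m] _]; rewrite /F ifN ?mul0r //; lia.
rewrite -{1}[(N - i)%N]add0n big_addn.
have szp' : (size p <= N.+1.*2 - (N - i))%N by lia.
transitivity (x ^+ (N - i) * p.[x] + (- x) ^+ (N - i) * p.[- x]); last first.
  by rewrite px0 mulr0 add0r.
rewrite !(horner_coef_wide _ szp') !mulr_sumr -big_split big_mkord /=.
apply: eq_bigr => k _; rewrite /F.
have -> : (N <= k + (N - i) + i)%N by lia.
have -> : (k + (N - i) + i - N = k)%N by lia.
by rewrite [(- x) ^+ k]exprNn [(- x) ^+ (N - i)]exprNn !exprD; ring.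
Qed.

(** Reversing the rows turns the exponents [N, ..., 1] into [1, ..., N], which is a Vandermonde
    matrix with column [j] scaled by [y j]. The sign depends on [N] alone, so it cancels between two
    such determinants. *)
Lemma det_powers (R : comNzRingType) N (y : 'I_N -> R) :
  \det (\matrix_(i < N, j < N) y j ^+ (N - i)) =
  (-1) ^+ perm (@rev_ord_inj N) *
  ((\prod_(i < N) y i) * \prod_(i < N) \prod_(j < N | (i < j)%N) (y j - y i)).
Proof.
set s := perm _.
pose v := \row_j y j.
have -> : (\matrix_(i < N, j < N) y j ^+ (N - i)) =
  perm_mx s *m (Vandermonde N v *m diag_mx v).
  rewrite -row_permE; apply/matrixP => i j.
  rewrite !mxE (bigD1 j) //= big1 ?addr0 => [|k /negPf ne_kj]; last first.
    by rewrite !mxE ne_kj mulr0n mulr0.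
  rewrite !mxE eqxx mulr1n /s permE /= -exprSr.
  by have lt_iN := ltn_ord i; congr (_ ^+ _); lia.
rewrite !det_mulmx det_perm det_Vandermonde det_diag; congr (_ * _).
rewrite mulrC; congr (_ * _); first by apply: eq_bigr => i _; rewrite mxE.
by apply: eq_bigr => i _; apply: eq_bigr => j _; rewrite !mxE.
Qed.

(** Applied to [- (y i + y j)], this extracts the square of [pair_prod] from the product of the
    values [p.[- y j]]. *)
Lemma prod_symmetric (R : comNzRingType) N (f : 'I_N -> 'I_N -> R) :
  (forall i j, f i j = f j i) ->
  \prod_i \prod_j f i j =
  (\prod_i f i i) * (\prod_(i < N) \prod_(j < N | (i < j)%N) f i j) ^+ 2.
Proof.
move=> fC.
have -> : \prod_i \prod_j f i j = \prod_(i < N)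
   (f i i * ((\prod_(j < N | (i < j)%N) f i j) * \prod_(j < N | (j < i)%N) f i j)).
  apply: eq_bigr => i _; rewrite (bigD1 i) //=; congr (_ * _).
  rewrite (bigID (fun j : 'I_N => (i < j)%N)) /=; congr (_ * _);
    by apply: eq_bigl => j; rewrite -val_eqE /=; lia.
rewrite !big_split /= expr2; congr (_ * (_ * _)).
rewrite (exchange_big_dep xpredT) //=.
by apply: eq_bigr => j _; apply: eq_bigr => i _; rewrite fC.
Qed.

Definition pair_prod (R : nzRingType) N (y : 'I_N -> R) : R :=
  \prod_(i < N) \prod_(j < N | (i < j)%N) (- (y i + y j)).

(* By [hurwitz_mx_root], the product of the Hurwitz matrix with the Vandermonde
   matrix of the [y_i^2] is a scaled Vandermonde matrix of the [- y_i]. *)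
Lemma orlando_generic (R : idomainType) N (z : R) (y : 'I_N -> R) :
  2 != 0 :> R -> (forall i, y i != 0) ->
  (forall i j, i != j -> y i - y j != 0) ->
  (forall i j, i != j -> y i + y j != 0) ->
  \det (hurwitz_mx N (('X - z%:P) * \prod_i ('X - (y i)%:P))) =
  (\prod_i (- (z + y i))) * pair_prod y.
Proof.
move=> two_neq0 y_neq0 yB_neq0 yD_neq0.
set p := _ * \prod_i _; set H := hurwitz_mx N p.
have szp : (size p <= N.+2)%N.
  rewrite size_monicM ?monicXsubC ?monic_neq0 ?monic_prod_XsubC //.
  by rewrite size_XsubC size_prod_XsubC /index_enum -enumT size_enum_ord.
have rootp i : p.[y i] = 0.
  by rewrite hornerM horner_prod (bigD1 i) //= !hornerXsubC subrr mul0r mulr0.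
(* The block has order [N] while [p] has [N + 1] roots: only the [y j] give columns, and [z] enters
   through the values [p.[- y j]]. *)
pose A := \matrix_(i < N, j < N) (y j ^+ 2) ^+ (N - i).
pose B := \matrix_(i < N, j < N) (- y j) ^+ (N - i).
have HA : 2 *: (H *m A) = B *m diag_mx (\row_j p.[- y j]).
  apply/matrixP => i j; rewrite mxE [in LHS]mxE.
  under eq_bigr => k _ do rewrite [A k j]mxE.
  rewrite hurwitz_mx_root // mxE (bigD1 j) //= big1 ?addr0 => [|k /negPf ne_kj].
    by rewrite !mxE eqxx mulr1n.
  by rewrite !mxE ne_kj mulr0n mulr0.
move: (congr1 determinant HA).
rewrite detZ !det_mulmx det_diag !det_powers.
set e := (-1) ^+ _; have e_neq0 : e != 0 by rewrite signr_eq0.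
clearbody e.
set P1 := \prod_(i < N) \prod_(j < N | (i < j)%N) (- y j - - y i).
have P1_neq0 : P1 != 0.
  apply/prodf_neq0 => i _; apply/prodf_neq0 => j lt_ij.
  by rewrite opprK addrC yB_neq0 // -val_eqE /=; lia.
set Y := \prod_i - y i; have Y_neq0 : Y != 0.
  by apply/prodf_neq0 => i _; rewrite oppr_eq0.
have E_neq0 : pair_prod y != 0.
  apply/prodf_neq0 => i _; apply/prodf_neq0 => j lt_ij.
  by rewrite oppr_eq0 yD_neq0 // -val_eqE /=; lia.
have -> : \prod_i y i ^+ 2 = Y * Y.
  by rewrite -big_split; apply: eq_bigr => i _ /=; rewrite mulrNN expr2.
have -> : \prod_(i < N) \prod_(j < N | (i < j)%N) (y j ^+ 2 - y i ^+ 2) =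
  P1 * pair_prod y.
  rewrite -big_split; apply: eq_bigr => i _; rewrite -big_split.
  by apply: eq_bigr => j _ /=; ring.
have -> : \prod_i (\row_j p.[- y j]) 0 i =
  (\prod_i (- (z + y i))) * (2 ^+ N * Y * pair_prod y ^+ 2).
  transitivity ((\prod_i (- (z + y i))) * \prod_i \prod_j (- (y i + y j))).
    rewrite -big_split; apply: eq_bigr => i _ /=; rewrite mxE hornerM hornerXsubC.
    rewrite horner_prod; congr (_ * _); first by ring.
    by apply: eq_bigr => j _; rewrite hornerXsubC; ring.
  rewrite prod_symmetric => [|i j]; last by rewrite addrC.
  congr (_ * (_ * _)).
  have -> : 2 ^+ N = \prod_(i < N) 2 :> R by rewrite prodr_const card_ord.
  rewrite -big_split /=.
  by apply: eq_bigr => i _; ring.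
move=> eqdet.
(* This is the factor common to both sides of [eqdet]; the nonvanishing hypotheses serve to cancel
   it. *)
have : (2 ^+ N * e * Y * P1 * Y * pair_prod y) != 0.
  by do !apply: mulf_neq0 => //; apply: expf_neq0.
move/mulfI; apply.
by move: eqdet; set G := \prod_i _; move=> eqdet; ring: eqdet.
Qed.

Lemma map_hurwitz_mx (R S : nzRingType) (f : {rmorphism R -> S}) N (p : {poly R}) :
  map_mx f (hurwitz_mx N p) = hurwitz_mx N (map_poly f p).
Proof.
by apply/matrixP => i j; rewrite !mxE coef_map; case: ifP; rewrite ?rmorph0.
Qed.

(* The generic case applies to the roots [y i + (i + 1) X] over [F[X]]; then set X = 0. *)
Lemma orlando (F : numFieldType) N (z : F) (y : 'I_N -> F) :
  \det (hurwitz_mx N (('X - z%:P) * \prod_i ('X - (y i)%:P))) =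
  (\prod_i (- (z + y i))) * pair_prod y.
Proof.
pose Y i : {poly F} := (y i)%:P + i.+1%:R *: 'X.
(* Nonvanishing is read off the coefficient of ['X]: [i + 1], [i - j] and [i + j + 2] are nonzero in
   characteristic zero. *)
have coef1 i : (Y i)`_1 = i.+1%:R by rewrite coefD coefC coefZ coefX mulr1 add0r.
have natr_inj : injective (fun n => n%:R : F) by apply: mulrIn; rewrite oner_eq0.
have neq0_coef1 (p : {poly F}) : p`_1 != 0 -> p != 0.
  by apply: contra_neq => ->; rewrite coef0.
have two_neq0 : 2 != 0 :> {poly F} by rewrite -polyC_natr polyC_eq0 pnatr_eq0.
have Y_neq0 i : Y i != 0 by apply: neq0_coef1; rewrite coef1 pnatr_eq0.
have YB_neq0 i j : i != j -> Y i - Y j != 0.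
  move=> ne_ij; apply: neq0_coef1; rewrite coefB !coef1 subr_eq0.
  by apply: contra_neq ne_ij => /natr_inj[]; apply: val_inj.
have YD_neq0 i j : i != j -> Y i + Y j != 0.
  by move=> _; apply: neq0_coef1; rewrite coefD !coef1 -natrD pnatr_eq0.
have := congr1 (horner_eval 0) (orlando_generic z%:P two_neq0 Y_neq0 YB_neq0 YD_neq0).
have evY i : horner_eval 0 (Y i) = y i.
  by rewrite /horner_eval hornerD hornerC hornerZ hornerX mulr0 addr0.
have evz : horner_eval 0 z%:P = z by rewrite /horner_eval hornerC.
rewrite -det_map_mx map_hurwitz_mx rmorphM rmorphB /= map_polyX map_polyC /= evz.
rewrite rmorph_prod.
under eq_bigr => i _ do rewrite rmorphB /= map_polyX map_polyC /= evY.
move=> ->; rewrite rmorphM !rmorph_prod; congr (_ * _).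
  by apply: eq_bigr => i _; rewrite rmorphN rmorphD /= evY evz.
apply: eq_bigr => i _; rewrite rmorph_prod; apply: eq_bigr => j _.
by rewrite rmorphN rmorphD /= !evY.
Qed.

(** In Orlando's product, the pairs containing [z] contribute [g.[- z]], and the remaining pairs
    form the same product for [g]. This recursion allows roots to be removed one at a time. *)
Lemma det_hurwitz_mxM (F : numClosedFieldType) (z : F) (g : {poly F}) :
  g \is monic ->
  \det (hurwitz_mx (size g).-1 (('X - z%:P) * g)) =
  g.[- z] * \det (hurwitz_mx (size g).-2 g).
Proof.
move=> g_monic; have [s] := closed_field_poly_normal g.
rewrite (monicP g_monic) scale1r => ->; rewrite size_prod_XsubC /=.
rewrite (big_nth 0) big_mkord orlando.
rewrite horner_prod; congr (_ * _).
  by apply: eq_bigr => i _; rewrite hornerXsubC opprD.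
(* For [g = 1] both determinants are empty; otherwise the first root of [g] takes the place of [z]
   in [orlando]. *)
case: (size s) => [|N] /=; first by rewrite det_mx00 /pair_prod big_ord0.
rewrite [X in hurwitz_mx _ X]big_ord_recl orlando /pair_prod big_ord_recl.
rewrite big_mkcond big_ord_recl /= mul1r; congr (_ * _).
apply: eq_bigr => i _.
by rewrite big_mkcond big_ord_recl /= mul1r -big_mkcond.
Qed.

(** * Stable real polynomials *)

Section RealPolynomials.
Variable R : rcfType.
Local Notation "p ^C" := (map_poly (real_complex R) p) (at level 1, format "p ^C").
Local Notation Re := (@complex.Re R).
Local Notation Im := (@complex.Im R).
Implicit Types (p q : {poly R}) (z w : R[i]).

Definition stable_poly p := forall z, root p^C z -> Re z < 0.

(** In degree [n] the size is [n + 1], so the block has order [n - 1] and this is the minor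
    [Delta_{n-1}]. *)
Definition hurwitz_det p := \det (hurwitz_mx (size p).-2 p).

Lemma hurwitz_detC p : (hurwitz_det p)%:C%C = \det (hurwitz_mx (size p).-2 p^C).
Proof. by rewrite /hurwitz_det -det_map_mx map_hurwitz_mx. Qed.

Lemma hurwitz_det_XsubCM (a : R) q : q \is monic ->
  hurwitz_det (('X - a%:P) * q) = q.[- a] * hurwitz_det q.
Proof.
move=> q_monic; apply: complexI; rewrite [RHS]rmorphM /= !hurwitz_detC.
rewrite size_monicM ?monicXsubC ?monic_neq0 // size_XsubC /=.
rewrite rmorphM rmorphB /= map_polyX map_polyC /=.
have qC_monic : q^C \is monic by rewrite map_monic.
have := det_hurwitz_mxM a%:C%C qC_monic; rewrite size_map_poly => ->.
by rewrite -rmorphN horner_map.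
Qed.

Lemma conjc_horner q z : (q^C.[z])^*%C = q^C.[z^*%C].
Proof.
rewrite -(horner_map (conjc (R:=R))) /= -map_poly_comp.
by congr _.[_]; apply: eq_map_poly => x /=; rewrite oppr0.
Qed.

(** The real quadratic [r] with roots [z] and its conjugate divides [p] over the complex numbers,
    its two factors being coprime. Divisibility descends to the reals, which makes the cofactor
    real. *)
Lemma nonreal_root_factor p z : p \is monic -> root p^C z -> Im z != 0 ->
  exists2 q, q \is monic &
    p^C = ('X - z%:P) * (('X - (z^*%C)%:P) * q^C) /\ size p = (size q).+2.
Proof.
move=> p_monic pz0 Imz.
pose r : {poly R} := 'X^2 - (2 * Re z) *: 'X + ((Re z) ^+ 2 + (Im z) ^+ 2)%:P.
have rE : r^C = ('X - z%:P) * ('X - (z^*%C)%:P).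
  rewrite /r rmorphD rmorphB /= map_polyXn map_polyZ map_polyX map_polyC /=.
  rewrite [RHS](_ : _ = 'X^2 - (z + z^*%C)%:P * 'X + (z * z^*%C)%:P); last first.
    by rewrite polyCD polyCM; ring.
  have <- : (2 * Re z)%:C%C = z + z^*%C by rewrite addcJ rmorphM /= rmorph_nat.
  by rewrite -sqr_normc -add_Re2_Im2 -mul_polyC.
have r_monic : r \is monic.
  by rewrite -(map_monic (real_complex R)) rE monicMl monicXsubC.
have pzJ : root p^C z^*%C.
  by rewrite /root -conjc_horner conjc_eq0.
have neq_zJ : z != z^*%C.
  case: z Imz {r rE r_monic pz0 pzJ} => a b /= b_neq0; rewrite eq_complex /= eqxx /=.
  by apply: contra b_neq0; move/eqP => bN; apply/eqP; lra.
have r_dvd : r %| p.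
  rewrite -(dvdp_map (real_complex R)) rE Gauss_dvdp; last first.
    by rewrite coprimep_XsubC root_XsubC eq_sym.
  by rewrite !dvdp_XsubCl pz0 pzJ.
have pE : p = r * (p %/ r) by rewrite mulrC divpK.
have q_monic : p %/ r \is monic by rewrite -(monicMl _ r_monic) -pE.
exists (p %/ r) => //; split; first by rewrite {1}pE rmorphM /= rE mulrA.
rewrite {1}pE size_monicM ?monic_neq0 //.
rewrite -(size_map_poly (real_complex R) r) rE.
by rewrite size_monicM ?monicXsubC ?monic_neq0 ?monicXsubC // !size_XsubC.
Qed.

(** Two steps of the recursion: the conjugate root contributes the conjugate of [q^C.[- z]], and [z]
    contributes [- (2 * Re z)] times [q^C.[- z]]. *)
Lemma hurwitz_det_conjM p q z : q \is monic -> size p = (size q).+2 ->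
  p^C = ('X - z%:P) * (('X - (z^*%C)%:P) * q^C) ->
  (hurwitz_det p)%:C%C =
  (- (2 * Re z))%:C%C * (q^C.[- z] * (q^C.[- z])^*%C) * (hurwitz_det q)%:C%C.
Proof.
move=> q_monic szp pE; have qC_monic : q^C \is monic by rewrite map_monic.
have q_gt0 : (0 < size q)%N by rewrite size_poly_gt0 monic_neq0.
have szq : size (('X - (z^*%C)%:P) * q^C) = (size q).+1.
  by rewrite size_monicM ?monicXsubC ?monic_neq0 // size_XsubC size_map_poly.
have := @det_hurwitz_mxM _ z (('X - (z^*%C)%:P) * q^C).
rewrite monicMl ?monicXsubC // => /(_ qC_monic).
have := det_hurwitz_mxM z^*%C qC_monic.
rewrite !hurwitz_detC szp szq size_map_poly pE /= => -> ->.
rewrite conjc_horner rmorphN /= hornerM hornerXsubC -opprD addcJ.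
rewrite rmorphN rmorphM /= rmorph_nat; ring.
Qed.

Lemma hurwitz_det_imaginary_root p z : p \is monic -> p.[0] != 0 ->
  root p^C z -> Re z = 0 -> hurwitz_det p = 0.
Proof.
move=> p_monic p0 pz0 Rez.
have Imz : Im z != 0.
  apply: contra_neq p0 => Imz; apply: complexI.
  have z0 : z = 0%:C%C by case: z Rez Imz {pz0} => a b /= -> ->.
  by move: pz0; rewrite z0 /root horner_map => /eqP.
have [q q_monic [pE szp]] := nonreal_root_factor p_monic pz0 Imz.
apply: complexI; rewrite (hurwitz_det_conjM q_monic szp pE) Rez.
by rewrite mulr0 oppr0 !mul0r.
Qed.

(** Induction on the degree, removing a real root or a conjugate pair. Positivity is carried on the
    whole half-line because removing a real root [a < 0] multiplies the determinant by [q.[- a]]. *)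
Lemma stable_poly_gt0 p : p \is monic -> stable_poly p ->
  (forall x, 0 <= x -> 0 < p.[x]) /\ 0 < hurwitz_det p.
Proof.
elim: {p}(size p) {-2}p (leqnn (size p)) => [p|n IHn p szp p_monic p_stable].
  by rewrite leqn0 size_poly_eq0 => /eqP-> /monic_neq0; rewrite eqxx.
have [/eqP szp1|szp1] := boolP (size p == 1%N).
  move: p_monic; have [c c_neq0 ->] := size_poly1P p (introT eqP szp1).
  rewrite monicE lead_coefC => /eqP->; split=> [x _|]; first by rewrite hornerC.
  by rewrite /hurwitz_det size_polyC oner_eq0 /= det_mx00.
have [z pz0] : exists z, root p^C z.
  by apply/closed_rootP; rewrite size_map_poly.
have Rez := p_stable z pz0.
have [Imz|Imz] := eqVneq (Im z) 0.
  have zE : z = (Re z)%:C%C by case: z Imz {pz0 Rez} => a b /= ->.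
  move: pz0; rewrite zE /root horner_map fmorph_eq0.
  move/factor_theorem => [q]; rewrite mulrC => pE.
  have q_monic : q \is monic by move: p_monic; rewrite pE monicMl // monicXsubC.
  have szpE : size p = (size q).+1.
    by rewrite pE size_monicM ?monicXsubC ?monic_neq0 // size_XsubC.
  have q_stable : stable_poly q.
    by move=> w qw; apply: p_stable; rewrite pE rmorphM rootM qw orbT.
  have [|q_gt0 qd] := IHn q _ q_monic q_stable; first by rewrite -ltnS -szpE.
  split=> [x x_ge0|].
    rewrite pE hornerM hornerXsubC mulr_gt0 ?q_gt0 //; lra.
  by rewrite pE hurwitz_det_XsubCM // mulr_gt0 // q_gt0 //; lra.
have [q q_monic [pE szp2]] := nonreal_root_factor p_monic pz0 Imz.
have q_stable : stable_poly q.
  by move=> w qw; apply: p_stable; rewrite pE !rootM qw !orbT.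
have [|q_gt0 qd] := IHn q _ q_monic q_stable; first by move: szp; rewrite szp2; lia.
split=> [x x_ge0|]; rewrite -ltcR.
  rewrite -horner_map pE !hornerM !hornerXsubC horner_map mulrA.
  rewrite mulr_gt0 //; last by rewrite ltcR q_gt0.
  (* For real [x] the quadratic factor is the squared modulus of [x - z], positive since [z] is not
     real. *)
  have -> : x%:C%C - z^*%C = (x%:C%C - z)^*%C by rewrite rmorphB /= oppr0.
  rewrite lt0r mulcJ_ge0 andbT mulf_neq0 ?conjc_eq0 //;
    by apply: contra_neq Imz => /(congr1 Im); case: z {pE pz0 Rez} => a b /=; lra.
rewrite (hurwitz_det_conjM q_monic szp2 pE).
(* The real part of [- z] is positive, so [- z] cannot be a root of the stable [q]. *)
have qNz : q^C.[- z] != 0.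
  apply/negP => /q_stable; case: z Rez {pE pz0 Imz} => a b /=; lra.
have qqJ_gt0 : 0 < q^C.[- z] * (q^C.[- z])^*%C.
  by rewrite lt0r mulcJ_ge0 andbT mulf_neq0 // conjc_eq0.
by apply: mulr_gt0; rewrite ?ltcR //; apply: mulr_gt0; rewrite // ltcR; lra.
Qed.

(** * Perturbation of the roots of a polynomial *)

Local Notation nrm := (@Normc.normc R).

Lemma nrm_sum I (r : seq I) (F : I -> R[i]) :
  nrm (\sum_(i <- r) F i) <= \sum_(i <- r) nrm (F i).
Proof.
elim/big_rec2: _ => [|i x y _ le_xy]; first by rewrite Normc.normc0.
by apply: le_trans (le_normcD _ _) _; rewrite lerD2l.
Qed.

Lemma nrm_ge0 z : 0 <= nrm z.
Proof. by case: z => a b; apply: sqrtr_ge0. Qed.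

Lemma nrmX z k : nrm (z ^+ k) = nrm z ^+ k.
Proof.
elim: k => [|k IHk]; first by rewrite !expr0 Normc.normc1.
by rewrite !exprS Normc.normcM IHk.
Qed.

Lemma nrm_real (a : R) : nrm a%:C%C = `|a|.
Proof. by rewrite /= expr0n addr0 sqrtr_sqr. Qed.

Lemma Re_le_nrm z : Re z <= nrm z.
Proof.
case: z => a b /=; apply: le_trans (ler_norm _) _.
by rewrite -sqrtr_sqr ler_wsqrtr // lerDl sqr_ge0.
Qed.

(** Each power of [nrm w] up to [n] is at most [(1 + nrm w) ^+ n]. This form of the bound holds for
    every [w] and compares directly with a lower bound of order [(1 + nrm w) ^+ n]. *)
Lemma horner_close n p q (eta : R) w : (size p <= n.+1)%N -> (size q <= n.+1)%N ->
  (forall k, `|p`_k - q`_k| <= eta) ->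
  nrm (p^C.[w] - q^C.[w]) <= eta * n.+1%:R * (1 + nrm w) ^+ n.
Proof.
move=> szp szq close; rewrite -hornerN -hornerD -rmorphB /=.
have szpq : (size (p - q)^C <= n.+1)%N.
  by rewrite size_map_poly (leq_trans (size_polyD _ _)) // size_polyN geq_max szp.
rewrite (horner_coef_wide _ szpq); apply: le_trans (nrm_sum _ _) _.
have -> : eta * n.+1%:R * (1 + nrm w) ^+ n = \sum_(k < n.+1) (eta * (1 + nrm w) ^+ n).
  by rewrite sumr_const card_ord -mulr_natr; ring.
apply: ler_sum => k _; rewrite Normc.normcM nrmX coef_map nrm_real coefB.
have w_ge0 := nrm_ge0 w.
apply: ler_pM => //; first exact: exprn_ge0.
apply: (@le_trans _ _ ((1 + nrm w) ^+ k)); first by apply: lerXn2r; rewrite ?nnegrE; lra.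
by apply: ler_weXn2l; [lra | rewrite -ltnS].
Qed.

(** A monic polynomial is the product of its factors [w - z], each of modulus at least [c]. *)
Lemma nrm_horner_ge p w (c : R) : p \is monic -> 0 <= c ->
  (forall z, root p^C z -> c <= nrm (w - z)) -> c ^+ (size p).-1 <= nrm p^C.[w].
Proof.
move=> p_monic c_ge0; have [s] := closed_field_poly_normal p^C.
have pC_monic : p^C \is monic by rewrite map_monic.
rewrite -(size_map_poly (real_complex R)) (monicP pC_monic) scale1r => ->.
rewrite size_prod_XsubC /= horner_prod.
elim: s => [|z s IHs] far; first by rewrite big_nil Normc.normc1.
rewrite big_cons Normc.normcM exprS hornerXsubC; apply: ler_pM => //.
- exact: exprn_ge0.
- by apply: far; rewrite root_prod_XsubC mem_head.
apply: IHs => u; rewrite root_prod_XsubC => us; apply: far.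
by rewrite root_prod_XsubC inE us orbT.
Qed.

(* If all roots of [q] were in the closed left half plane, then [|q(z)|] would be
   at least [(Re z)^n], while it is close to [|p(z)| = 0]. *)
Lemma unstable_near n p z : size p = n.+1 -> root p^C z -> 0 < Re z ->
  exists2 eta : R, 0 < eta & forall q, q \is monic -> size q = n.+1 ->
    (forall k, `|q`_k - p`_k| <= eta) -> exists2 w, root q^C w & 0 < Re w.
Proof.
move=> szp pz0 Rez; have z_ge0 := nrm_ge0 z.
(* The extra [1] makes the bound of [horner_close] equal to [Re z ^+ n] times [(n + 1) / (n + 2)],
   strictly below [Re z ^+ n]. *)
pose B := (n.+1%:R + 1) * (1 + nrm z) ^+ n.
have n_ge0 : 0 <= n.+1%:R :> R by [].
have X_gt0 : 0 < (1 + nrm z) ^+ n by apply: exprn_gt0; lra.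
have B_gt0 : 0 < B by apply: mulr_gt0 => //; lra.
have zn_gt0 : 0 < Re z ^+ n by apply: exprn_gt0.
exists (Re z ^+ n / B) => [|q q_monic szq close]; first exact: divr_gt0.
have [s] := closed_field_poly_normal q^C.
have qC_monic : q^C \is monic by rewrite map_monic.
rewrite (monicP qC_monic) scale1r => qE.
have [/hasP[w ws Rew]|/hasPn no_root] := boolP (has (fun w => 0 < Re w) s).
  by exists w => //; rewrite qE root_prod_XsubC.
have far w : root q^C w -> Re z <= nrm (z - w).
  rewrite qE root_prod_XsubC => /no_root; rewrite -leNgt => Rew.
  apply: le_trans (Re_le_nrm _).
  by case: (z) (w) Rew => a b [a' b'] /=; lra.
have := nrm_horner_ge q_monic (ltW Rez) far.
have := @horner_close n q p _ z _ _ close; rewrite szp szq => /(_ (leqnn _) (leqnn _)).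
rewrite (rootP pz0) subr0 /= => le1 le2; have := le_trans le2 le1.
have -> : Re z ^+ n / B * n.+1%:R * (1 + nrm z) ^+ n =
   Re z ^+ n * (n.+1%:R / (n.+1%:R + 1)).
  by rewrite /B; field; rewrite !gt_eqF //; lra.
by rewrite ler_pMr // ler_pdivlMr; lra.
Qed.

Lemma stable_near n p : p \is monic -> size p = n.+1 -> stable_poly p ->
  exists2 eta : R, 0 < eta & forall q, q \is monic -> size q = n.+1 ->
    (forall k, `|q`_k - p`_k| <= eta) -> stable_poly q.
Proof.
move=> p_monic szp p_stable.
have [s] := closed_field_poly_normal p^C.
have pC_monic : p^C \is monic by rewrite map_monic.
rewrite (monicP pC_monic) scale1r => pE.
(* The roots being finite in number, they share a distance [d] from the imaginary axis and a bound
   [K] on their moduli. *)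
have [d d_gt0 [K K_ge0 dK]] : exists2 d : R, 0 < d & exists2 K : R, 0 <= K &
    forall z, z \in s -> Re z <= - d /\ nrm z <= K.
  have : forall z, z \in s -> Re z < 0.
    by move=> z zs; apply: p_stable; rewrite pE root_prod_XsubC.
  elim: (s) => [|z t IHt] neg; first by exists 1 => //; exists 0.
  have [|d d_gt0 [K K_ge0 dK]] := IHt; first by move=> u ut; rewrite neg ?inE ?ut ?orbT.
  have Rez : Re z < 0 by rewrite neg ?mem_head.
  have z_ge0 := nrm_ge0 z.
  exists (Num.min d (- Re z)); first by rewrite lt_min d_gt0 oppr_gt0.
  exists (K + nrm z); first lra.
  have le1 : Num.min d (- Re z) <= d by rewrite ge_min lexx.
  have le2 : Num.min d (- Re z) <= - Re z by rewrite ge_min lexx orbT.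
  move=> u; rewrite inE => /predU1P[->|/dK[]]; split; lra.
(* For [Re w >= 0], every root [z] of [p] satisfies [|w - z| >= c (1 + |w|)], so
   [|p(w)|] dominates the perturbation uniformly in [w]. *)
pose c := d / (1 + K + d).
have c_gt0 : 0 < c by apply: divr_gt0 => //; lra.
have n_ge0 : 0 <= n.+1%:R :> R by [].
have cn_gt0 : 0 < c ^+ n by apply: exprn_gt0.
exists (c ^+ n / (n.+1%:R + 1)) => [|q q_monic szq close].
  by apply: divr_gt0 => //; lra.
move=> w qw0; rewrite ltNge; apply/negP => Rew; have w_ge0 := nrm_ge0 w.
have far z : root p^C z -> c * (1 + nrm w) <= nrm (w - z).
  rewrite pE root_prod_XsubC => /dK[Rez zK].
  have le1 : nrm w <= nrm (w - z) + nrm z by rewrite -{1}(subrK z w) le_normcD.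
  have le2 : Re w - Re z <= nrm (w - z).
    by apply: le_trans (Re_le_nrm _); case: (w) (z) => a b [a' b'].
  (* With [t = nrm (w - z)], one has [t >= d] and [t >= nrm w - K]. Weights [1 + K] and [d] give
     [t * (1 + K + d) >= d * (1 + nrm w)], whence the choice of [c]. *)
  rewrite /c mulrAC ler_pdivrMr; last lra.
  by nra.
clearbody c.
have cw_ge0 : 0 <= c * (1 + nrm w) by apply: mulr_ge0; lra.
have := nrm_horner_ge p_monic cw_ge0 far.
have := @horner_close n q p _ w _ _ close; rewrite szp szq => /(_ (leqnn _) (leqnn _)).
rewrite (rootP qw0) sub0r normcN /= => le1 le2; have := le_trans le2 le1.
have w1_gt0 : 0 < (1 + nrm w) ^+ n by apply: exprn_gt0; lra.
have -> : c ^+ n / (n.+1%:R + 1) * n.+1%:R * (1 + nrm w) ^+ n =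
   (c * (1 + nrm w)) ^+ n * (n.+1%:R / (n.+1%:R + 1)).
  by rewrite exprMn; ring.
rewrite ler_pMr; last by rewrite exprMn mulr_gt0.
by rewrite ler_pdivlMr; lra.
Qed.

End RealPolynomials.

(** * Transfer to matrices *)

Lemma lsum_morph (T : Type) zero add (V : nmodType) (f : T -> V) (g : nat -> T) m :
  f zero = 0 -> {morph f : x y / add x y >-> x + y} ->
  f (lsum zero add g m) = \sum_(j < m) f (g j).
Proof.
move=> f0 fD; elim: m => [|m IHm] /=; first by rewrite big_ord0.
by rewrite big_ord_recr fD IHm.
Qed.

(** The source carries bare operations without ring laws, so a single lemma interprets [gdet] over
    coefficient lists, reals and pairs of reals. The induction is the Laplace expansion along the
    first row. *)
Lemma gdet_morph (T : Type) zero one add mul opp (R : comNzRingType) (f : T -> R) k M :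
  f zero = 0 -> f one = 1 -> {morph f : x y / add x y >-> x + y} ->
  {morph f : x y / mul x y >-> x * y} -> {morph f : x / opp x >-> - x} ->
  f (gdet zero one add mul opp k M) = \det (\matrix_(i < k, j < k) f (M i j)).
Proof.
move=> f0 f1 fD fM fN; elim: k M => [|k IHk] M; first by rewrite det_mx00.
rewrite [gdet _ _ _ _ _ _ _]/= -/(lsum zero add _ k.+1).
rewrite (lsum_morph _ k.+1 f0 fD) (expand_det_row _ ord0).
apply: eq_bigr => j _; rewrite mxE /cofactor /= add0n.
have -> : row' ord0 (col' j (\matrix_(i < k.+1, j0 < k.+1) f (M i j0))) =
   \matrix_(i < k, j0 < k) f (minor M j i j0).
  apply/matrixP => a b; rewrite !mxE /= /bump /minor add1n.
  rewrite (_ : (b <? j)%coq_nat = (b < j)%N); last first.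
    by apply/idP/idP => [/Nat.ltb_lt/ssrnat.ltP|/ssrnat.ltP/Nat.ltb_lt].
  by case: leqP.
have -> : Nat.even j = ~~ odd j.
  by elim: (nat_of_ord j) => // m IHm; rewrite Nat.even_succ -Nat.negb_even IHm negbK.
rewrite -signr_odd; case: (odd j) => /=; rewrite ?fN fM IHk ?expr0 ?expr1; ring.
Qed.

Definition mx_of n (A : mat) : 'M[R]_n := \matrix_(i, j) A i j.
Definition chi n A : {poly R} := char_poly (mx_of n A).

Lemma list_nthE (s : list R) k : List.nth k s 0%R = s`_k.
Proof. by elim: s k => [|a s IHs] [|k] //=. Qed.

Lemma Poly_padd p q : Poly (padd p q) = Poly p + Poly q.
Proof.
apply/polyP => k; rewrite coefD !coef_Poly.
elim: p q k => [|a p IHp] [|b q] [|k] //=; rewrite ?add0r ?addr0 ?nth_nil //.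
Qed.

Lemma Poly_popp p : Poly (popp p) = - Poly p.
Proof.
apply/polyP => k; rewrite coefN !coef_Poly.
by elim: p k => [|a p IHp] [|k] //=; rewrite oppr0.
Qed.

Lemma Poly_pmul p q : Poly (pmul p q) = Poly p * Poly q.
Proof.
elim: p => [|a p IHp] /=; first by rewrite mul0r.
rewrite Poly_padd /= IHp !cons_poly_def mulrDl addr0 addrC -mulrA [Poly q * _]mulrC mulrA.
congr (_ + _); apply/polyP => k; rewrite coefCM !coef_Poly.
by elim: q k {IHp} => [|b q IHq] [|k] //=; rewrite mulr0.
Qed.

Lemma Poly_charpoly n A : Poly (charpoly n A) = chi n A.
Proof.
rewrite /charpoly gdet_morph //;
  [|by rewrite /= cons_poly_def mul0r add0r|exact: Poly_padd|exact: Poly_pmul|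
   exact: Poly_popp].
congr (\det _); apply/matrixP => i j.
rewrite !mxE Poly_padd Poly_popp /= cons_poly_def mul0r add0r.
congr (_ - _); rewrite -val_eqE /=.
have [eq_ij|ne_ij] := eqVneq (i : nat) j.
  by rewrite (introT (Nat.eqb_spec i j) eq_ij) /= !cons_poly_def mul0r add0r mul1r addr0.
by case: (Nat.eqb_spec i j) => [/eqP|_]; rewrite ?(negPf ne_ij).
Qed.

Lemma charcoef_nat n A k : charcoef n A (Z.of_nat k) = (chi n A)`_k.
Proof.
have szX : size (chi n A) = n.+1 := size_char_poly _.
rewrite /charcoef; case: Z.eqb_spec => [/Nat2Z.inj ->|ne_kn].
  by have := monicP (char_poly_monic (mx_of n A)); rewrite lead_coefE szX.
have -> : Z.leb Z0 (Z.of_nat k) by apply/Z.leb_le; lia.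
case: Z.ltb_spec => [lt_kn|le_nk] /=.
  by rewrite Nat2Z.id list_nthE -coef_Poly Poly_charpoly.
by rewrite nth_default // szX; lia.
Qed.

Lemma charcoef_neg n A k : Z.lt k Z0 -> charcoef n A k = 0.
Proof.
move=> k_lt0; rewrite /charcoef; case: Z.eqb_spec => [|_]; first by lia.
by case: Z.leb_spec => // ?; lia.
Qed.

Lemma hurwitz_minorE n A : hurwitz_minor n A (n - 1) = hurwitz_det (chi n A).
Proof.
rewrite /hurwitz_minor (gdet_morph (f := id)) // /hurwitz_det size_char_poly /=.
rewrite subn1; congr (\det _); apply/matrixP => i j; rewrite !mxE /hurwitz_matrix.
have lt_in := ltn_ord i; have lt_jn := ltn_ord j.
(* Where the guard of [hurwitz_mx] fails, the integer index of [charcoef] is negative and the entry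
   is zero. *)
case: leqP => [le_j|lt_j]; last by rewrite charcoef_neg //; lia.
by rewrite -charcoef_nat; congr charcoef; lia.
Qed.

Definition toC (z : Defs.C) : R[i] := (z.1 +i* z.2)%C.

(** The embedding of the reals and evaluation at [lam] are ring morphisms, hence commute with the
    determinant. *)
Lemma eigenvalueE n A lam :
  Defs.eigenvalue n A lam <-> root (map_poly (real_complex R) (chi n A)) (toC lam).
Proof.
rewrite /Defs.eigenvalue.
set d := gdet _ _ _ _ _ _ _.
have -> : root (map_poly (real_complex R) (chi n A)) (toC lam) = (toC d == 0).
  rewrite /d gdet_morph //.
  rewrite /root /chi /char_poly -det_map_mx -[_.[_]]/(horner_eval _ _) -det_map_mx.
  congr (\det _ == 0); apply/matrixP => i j; rewrite !mxE /= rmorphB rmorphMn /=.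
  rewrite map_polyX map_polyC /= /horner_eval hornerD hornerN hornerMn hornerX hornerC.
  case: (Nat.eqb_spec i j) => [eq_ij|ne_ij].
    have -> : i == j by apply/eqP/val_inj.
    by rewrite mulr1n.
  have -> : (i == j) = false by apply/eqP => eq_ij; case: ne_ij; rewrite eq_ij.
  by rewrite mulr0n.
by case: d => a b; rewrite /toC /=; split=> [[-> ->]|/eqP[-> ->]].
Qed.

Lemma hurwitz_stableE n A : hurwitz_stable n A <-> stable_poly (chi n A).
Proof.
split=> [stA z rz|stA lam /eigenvalueE/stA/RltP //].
have /stA/RltP : Defs.eigenvalue n A (complex.Re z, complex.Im z).
  by apply/eigenvalueE; case: z rz.
by [].
Qed.

(** * Continuity of the characteristic coefficients in the matrix entries *)

Definition entries_close n (eps : R) (X Y : mat) :=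
  forall i j, (i < n)%N -> (j < n)%N -> `|Y i j - X i j| < eps.

Definition continuous_at n (X : mat) (F : mat -> R) :=
  forall eta : R, 0 < eta -> exists2 eps : R, 0 < eps &
    forall Y, entries_close n eps X Y -> `|F Y - F X| < eta.

Lemma entries_close_min n (e1 e2 : R) X Y : entries_close n (Num.min e1 e2) X Y ->
  entries_close n e1 X Y /\ entries_close n e2 X Y.
Proof.
by move=> XY; split=> i j ltin ltjn;
  have := XY i j ltin ltjn; rewrite lt_min => /andP[].
Qed.

Lemma continuous_at_cst n X (c : R) : continuous_at n X (fun=> c).
Proof. by move=> eta eta_gt0; exists 1 => // Y _; rewrite subrr normr0. Qed.

Lemma continuous_atD n X F G : continuous_at n X F -> continuous_at n X G ->
  continuous_at n X (fun Y => F Y + G Y).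
Proof.
move=> cF cG eta eta_gt0; have eta2 : 0 < eta / 2 by lra.
have [e1 e1_gt0 FP] := cF _ eta2; have [e2 e2_gt0 GP] := cG _ eta2.
exists (Num.min e1 e2) => [|Y /entries_close_min[/FP le1 /GP le2]].
  by rewrite lt_min e1_gt0.
rewrite opprD addrACA; apply: le_lt_trans (ler_normD _ _) _; lra.
Qed.

Lemma continuous_atM n X F G : continuous_at n X F -> continuous_at n X G ->
  continuous_at n X (fun Y => F Y * G Y).
Proof.
move=> cF cG eta eta_gt0.
pose K := 1 + `|F X| + `|G X|.
have FX_ge0 := normr_ge0 (F X); have GX_ge0 := normr_ge0 (G X).
(* With both deviations below [d <= 1], the product moves by less than
   [d * (1 + |F X| + |G X|) = d * K <= eta]. *)
pose d := Num.min 1 (eta / K).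
have K_gt0 : 0 < K by rewrite /K; lra.
have d_gt0 : 0 < d by rewrite lt_min ltr01 divr_gt0.
have d_le1 : d <= 1 by rewrite ge_min lexx.
have dK : d * K <= eta by rewrite -ler_pdivlMr // ge_min lexx orbT.
have [e1 e1_gt0 FP] := cF _ d_gt0; have [e2 e2_gt0 GP] := cG _ d_gt0.
exists (Num.min e1 e2) => [|Y /entries_close_min[/FP le1 /GP le2]].
  by rewrite lt_min e1_gt0.
rewrite (_ : _ - _ = (F Y - F X) * (G Y - G X) + (F X * (G Y - G X) + G X * (F Y - F X)));
  last by ring.
apply: le_lt_trans (ler_normD _ _) _; rewrite normrM.
have le3 := ler_normD (F X * (G Y - G X)) (G X * (F Y - F X)).
rewrite !normrM in le3.
have F_ge0 := normr_ge0 (F Y - F X); have G_ge0 := normr_ge0 (G Y - G X).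
by rewrite /K in dK; nra.
Qed.

Lemma continuous_at_sum n X I (r : seq I) (F : I -> mat -> R) :
  (forall i, continuous_at n X (F i)) ->
  continuous_at n X (fun Y => \sum_(i <- r) F i Y).
Proof.
move=> cF; elim: r => [|i r IHr] eta eta_gt0.
  have [e e_gt0 eP] := continuous_at_cst n X 0 eta_gt0.
  by exists e => // Y /eP; rewrite !big_nil.
have [e e_gt0 eP] := continuous_atD (cF i) IHr eta_gt0.
by exists e => // Y /eP; rewrite !big_cons.
Qed.

Definition coef_continuous_at n X (P : mat -> {poly R}) :=
  forall k, continuous_at n X (fun Y => (P Y)`_k).

Lemma coef_continuous_atM n X P Q :
  coef_continuous_at n X P -> coef_continuous_at n X Q ->
  coef_continuous_at n X (fun Y => P Y * Q Y).
Proof.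
move=> cP cQ k eta eta_gt0.
have cS : continuous_at n X (fun Y => \sum_(i < k.+1) (P Y)`_i * (Q Y)`_(k - i)).
  by apply: continuous_at_sum => i; apply: continuous_atM.
by have [e e_gt0 eP] := cS _ eta_gt0; exists e => // Y /eP; rewrite !coefM.
Qed.

Lemma coef_continuous_at_prod n X I (r : seq I) (P : I -> mat -> {poly R}) :
  (forall i, coef_continuous_at n X (P i)) ->
  coef_continuous_at n X (fun Y => \prod_(i <- r) P i Y).
Proof.
move=> cP; elim: r => [|i r IHr] k eta eta_gt0.
  have [e e_gt0 eP] := continuous_at_cst n X (1 : {poly R})`_k eta_gt0.
  by exists e => // Y /eP; rewrite !big_nil.
have [e e_gt0 eP] := coef_continuous_atM (cP i) IHr k eta_gt0.
by exists e => // Y /eP; rewrite !big_cons.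
Qed.

(** The Leibniz expansion writes the characteristic polynomial as a finite sum of products of
    entries of ['X I - Y]. *)
Lemma chi_coef_continuous_at n X : coef_continuous_at n X (chi n).
Proof.
move=> k eta eta_gt0.
pose T (s : 'S_n) Y := (-1) ^+ s * \prod_i (char_poly_mx (mx_of n Y)) i (s i).
have cT s : coef_continuous_at n X (T s).
  apply: coef_continuous_atM => [m|]; first exact: continuous_at_cst.
  (* A change of [Y] affects only the constant coefficient of an entry, and by exactly the change of
     that matrix entry, so [e] itself serves as radius. *)
  apply: coef_continuous_at_prod => i m e e_gt0; exists e => // Y XY.
  rewrite -coefB !mxE opprD addrACA subrr add0r opprK addrC -polyCB coefC.
  case: eqP => _; last by rewrite normr0.
  by rewrite distrC XY.
have cS : continuous_at n X (fun Y => \sum_s (T s Y)`_k).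
  by apply: continuous_at_sum => s; apply: cT.
have [e e_gt0 eP] := cS _ eta_gt0; exists e => // Y /eP.
by rewrite -!coef_sum.
Qed.

(** A minimum over the indices up to [n] gives one radius for all [k], since higher coefficients
    vanish. *)
Lemma chi_coef_near n X (eta : R) : 0 < eta -> exists2 eps : R, 0 < eps &
  forall Y, entries_close n eps X Y -> forall k, `|(chi n Y)`_k - (chi n X)`_k| <= eta.
Proof.
move=> eta_gt0.
have [e e_gt0 eP] : exists2 eps : R, 0 < eps & forall Y, entries_close n eps X Y ->
    forall k, (k < n.+1)%N -> `|(chi n Y)`_k - (chi n X)`_k| <= eta.
  elim: n.+1 => [|m [e1 e1_gt0 IHm]]; first by exists 1.
  have [e2 e2_gt0 mP] := @chi_coef_continuous_at n X m _ eta_gt0.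
  exists (Num.min e1 e2) => [|Y /entries_close_min[/IHm le1 /mP le2] k].
    by rewrite lt_min e1_gt0.
  by rewrite ltnS leq_eqVlt => /predU1P[->|/le1 //]; apply: ltW.
exists e => // Y /eP le_eta k; have [/le_eta //|le_nk] := ltnP k n.+1.
by rewrite !nth_default ?size_char_poly // subrr normr0 ltW.
Qed.

(** * Openness of the stable and unstable sets, and the criterion for one matrix *)

Lemma is_openI n (U : mat -> Prop) :
  (forall X, U X -> exists2 eps : R, 0 < eps & forall Y, entries_close n eps X Y -> U Y) ->
  is_open n U.
Proof.
move=> Uop X /Uop[e e_gt0 eP]; exists e; split; first exact/RltP.
move=> Y XY; apply: eP => i j /ssrnat.ltP ltin /ssrnat.ltP ltjn.
by have /RltP := XY i j ltin ltjn; rewrite RabsE.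
Qed.

(** Stronger than the failure of stability: roots on the imaginary axis do not count, which is what
    makes the condition open. *)
Definition unstable_poly (p : {poly R}) :=
  exists2 z, root (map_poly (real_complex R) p) z & 0 < complex.Re z.

Lemma open_hurwitz_stable n : is_open n (hurwitz_stable n).
Proof.
apply: is_openI => X /hurwitz_stableE stX.
have [eta eta_gt0 near] :=
  stable_near (char_poly_monic (mx_of n X)) (size_char_poly (mx_of n X)) stX.
have [e e_gt0 eP] := chi_coef_near n X eta_gt0; exists e => // Y /eP XY.
apply/hurwitz_stableE; apply: near XY; first exact: char_poly_monic.
exact: size_char_poly.
Qed.

Lemma open_unstable n : is_open n (fun A => unstable_poly (chi n A)).
Proof.
apply: is_openI => X [z rz Rez].
have [eta eta_gt0 near] := unstable_near (size_char_poly (mx_of n X)) rz Rez.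
have [e e_gt0 eP] := chi_coef_near n X eta_gt0; exists e => // Y /eP XY.
apply: near XY; first exact: char_poly_monic.
exact: size_char_poly.
Qed.

Lemma hurwitz_stable_gt0 n A : hurwitz_stable n A ->
  Rlt (IZR Z0) (charcoef n A Z0) /\ Rlt (IZR Z0) (hurwitz_minor n A (n - 1)).
Proof.
move=> /hurwitz_stableE stA.
have [pos det_gt0] := stable_poly_gt0 (char_poly_monic (mx_of n A)) stA.
split; apply/RltP; last by rewrite hurwitz_minorE.
by rewrite -[Z0]/(Z.of_nat 0) charcoef_nat -horner_coef0 pos.
Qed.

Lemma hurwitz_stable_of_gt0 n A :
  Rlt (IZR Z0) (charcoef n A Z0) -> Rlt (IZR Z0) (hurwitz_minor n A (n - 1)) ->
  ~ unstable_poly (chi n A) -> hurwitz_stable n A.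
Proof.
rewrite -[Z0]/(Z.of_nat 0) charcoef_nat hurwitz_minorE => /RltP a0_gt0 /RltP det_gt0.
move=> notU; apply/hurwitz_stableE => z rz; rewrite lt_neqAle andbC.
apply/andP; split; first by rewrite leNgt; apply/negP => Rez; apply: notU; exists z.
(* A root on the imaginary axis would annul the determinant, [a_0] being nonzero. *)
apply/eqP => Rez; move: det_gt0.
rewrite (hurwitz_det_imaginary_root (char_poly_monic _) _ rz Rez) ?ltxx //.
by rewrite horner_coef0 gt_eqF.
Qed.

Lemma hurwitz_stable_not_unstable n A :
  hurwitz_stable n A -> ~ unstable_poly (chi n A).
Proof.
move=> /hurwitz_stableE stA [z rz Rez].
by have := lt_trans Rez (stA z rz); rewrite ltxx.
Qed.

End Orlando.

Theorem theorem1 (n : nat) (Aset : mat -> Prop) :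
  (2 <= n)%nat ->
  connected n Aset ->
  (exists A, Aset A /\ hurwitz_stable n A) ->
  ((forall A, Aset A -> hurwitz_stable n A) <->
   (forall A, Aset A -> 0 < charcoef n A 0%Z /\ 0 < hurwitz_minor n A (n - 1))).
Proof.
intros _ Hconn [A0 [HA0 stA0]]; split.
  intros st A HA; apply Orlando.hurwitz_stable_gt0; auto.
intros pos A HA; destruct (pos A HA) as [a0 dA].
apply Orlando.hurwitz_stable_of_gt0; trivial.
(* An unstable [A] would yield a separation of [Aset], with [A0] in the stable part and [A] in the
   other. *)
intro uA; apply Hconn.
exists (hurwitz_stable n), (fun B => Orlando.unstable_poly (Orlando.chi n B)).
repeat split; eauto using Orlando.open_hurwitz_stable, Orlando.open_unstable.
- intros B HB; destruct (pos B HB) as [b0 dB].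
  (* Covering uses positivity at [B]: it excludes the imaginary axis, so [B] is stable once it is
     not unstable. *)
  destruct (classic (Orlando.unstable_poly (Orlando.chi n B))); auto.
  left; apply Orlando.hurwitz_stable_of_gt0; trivial.
- intros B _ stB; apply Orlando.hurwitz_stable_not_unstable; trivial.
Qed.
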